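(* Let $\mathbf{s}^l\in\mathcal{A}^l_e$ and let $\boldsymbol{\lambda}^l$ be an $l$-partition such that $(\boldsymbol{\lambda}^l,\mathbf{s}^l)$ is an $e$-core. Then for every $i\in\{0,\dots,e-1\}$ at least one of the following holds: (1) $\boldsymbol{\lambda}^l$ admits no addable $i$-node; (2) $\boldsymbol{\lambda}^l$ admits no removable $i$-node.
   Context: Fix integers $e\ge 2$, $l\ge 1$. An $l$-partition is an $l$-tuple $\boldsymbol{\lambda}^l=(\lambda^0,\dots,\lambda^{l-1})$ of partitions. Set $\mathcal{A}^l_e=\{(s_0,\dots,s_{l-1})\in\mathbb{Z}^l : 0\le s_j-s_i<e \text{ for all } 0\le i<j\le l-1\}$. For a partition $\lambda=(\lambda_1\ge\lambda_2\ge\cdots)$ (with $\lambda_k=0$ for large $k$) and $s\in\mathbb{Z}$, put $X^s(\lambda)=\{\lambda_j-j+s : j\ge 1\}\subset\mathbb{Z}$. The $l$-symbol of $(\boldsymbol{\lambda}^l,\mathbf{s}^l)$, with $\mathbf{s}^l=(s_0,\dots,s_{l-1})$, is $(X^0,\dots,X^{l-1})$ with $X^c=X^{s_c}(\lambda^c)$. For a set $X\subset\mathbb{Z}$ let $X[e]=\{x+e : x\in X\}$. For $\mathbf{s}^l\in\mathcal{A}^l_e$, the pair $(\boldsymbol{\lambda}^l,\mathbf{s}^l)$ is an $e$-core if its $l$-symbol satisfies $X^0\subset X^1\subset\cdots\subset X^{l-1}\subset X^0[e]$. Nodes: the Young diagram is $[\boldsymbol{\lambda}^l]=\{(a,b,c):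 a\ge 1,\ 0\le c\le l-1,\ 1\le b\le\lambda^c_a\}$. The residue of $(a,b,c)$ is $b-a+s_c$ modulo $e$. A removable $i$-node is a node $\gamma\in[\boldsymbol{\lambda}^l]$ of residue $i \bmod e$ such that $[\boldsymbol{\lambda}^l]\setminus\{\gamma\}$ is the Young diagram of an $l$-partition. An addable $i$-node is a triple $\gamma=(a,b,c)\notin[\boldsymbol{\lambda}^l]$ with $a,b\ge1$ and $0\le c\le l-1$, of residue $i \bmod e$, such that $[\boldsymbol{\lambda}^l]\cup\{\gamma\}$ is the Young diagram of an $l$-partition. *)

(* Defs.v *)
From mathcomp Require Import all_boot all_order all_algebra.
From mathcomp Require Import boolp classical_sets.

Set Implicit Arguments.
Unset Strict Implicit.
Unset Printing Implicit Defensive.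

Import Order.TTheory GRing.Theory Num.Theory.

Local Open Scope classical_set_scope.
Local Open Scope ring_scope.

(* A partition is stored as the list of its nonzero parts. *)
Record intpart := IntPart {
  parts : seq nat;
  partsP : sorted geq parts && (0%N \notin parts)
}.

(* la_j, indexed from j = 1; only meaningful for j >= 1. *)
Definition part (la : intpart) (j : nat) : nat := nth 0%N (parts la) j.-1.

Definition multipartition (l : nat) := 'I_l -> intpart.

Definition multicharge (l : nat) := 'I_l -> int.

Definition in_Ae (e l : nat) (s : multicharge l) : Prop :=
  forall i j : 'I_l, (i < j)%N -> 0 <= s j - s i < e%:Z.

Definition beta_set (s : int) (la : intpart) : set int :=
  [set (part la j)%:Z - j%:Z + s | j in [set j : nat | (1 <= j)%N]].

Definition symbol (l : nat) (la : multipartition l) (s : multicharge l)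
  (c : 'I_l) : set int := beta_set (s c) (la c).

Definition shift_set (e : nat) (X : set int) : set int := [set x + e%:Z | x in X].

(* X^0 c= X^1 c= ... c= X^(l-1) c= X^0[e], without assuming that l is
   syntactically a successor: in the second clause i and j are forced to be the
   first and the last index. *)
Definition is_core (e l : nat) (la : multipartition l) (s : multicharge l) :
    Prop :=
  (forall i j : 'I_l, j = i.+1 :> nat -> symbol la s i `<=` symbol la s j) /\
  (forall i j : 'I_l, i = 0%N :> nat -> j = l.-1 :> nat ->
     symbol la s j `<=` shift_set e (symbol la s i)).

(* (a, b, c): row, column, component; rows and columns are numbered from 1. *)
Definition node (l : nat) : Type := (nat * nat * 'I_l)%type.

Definition young_diagram (l : nat) (la : multipartition l) : set (node l) :=
  [set g | let: (a, b, c) := g in (1 <= a)%N /\ (1 <= b <= part (la c) a)%N].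

Definition is_young_diagram (l : nat) (D : set (node l)) : Prop :=
  exists mu : multipartition l, D = young_diagram mu.

Definition has_residue (e l : nat) (s : multicharge l) (i : nat) (g : node l) :
    Prop :=
  let: (a, b, c) := g in (b%:Z - a%:Z + s c = i%:Z %[mod e%:Z])%Z.

Definition removable_node (e l : nat) (la : multipartition l)
    (s : multicharge l) (i : nat) (g : node l) : Prop :=
  [/\ young_diagram la g,
      has_residue e s i g
    & is_young_diagram (young_diagram la `\` [set g])].

Definition addable_node (e l : nat) (la : multipartition l)
    (s : multicharge l) (i : nat) (g : node l) : Prop :=
  [/\ ~ young_diagram la g,
      (1 <= g.1.1)%N /\ (1 <= g.1.2)%N,
      has_residue e s i g
    & is_young_diagram (young_diagram la `|` [set g])].

(* Main.v *)
Require Import Defs.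
From mathcomp Require Import all_boot all_order all_algebra.
From mathcomp Require Import boolp classical_sets.
From mathcomp Require Import zify.

(** Read a component as an abacus whose beads sit at the elements of X^c.
    An addable node of content z (column minus row plus charge) is a bead at
    z - 1 with a gap at z; a removable node of content z is a bead at z with a
    gap at z - 1 ([addable_node_gap], [removable_node_gap]).

    In a core, a bead x of any component c forces a bead at x - k e in every
    component c' as soon as k > 0, and also for k = 0 when c <= c': this is
    what running around the cyclic chain of inclusions gives
    ([core_bead_below]).

    Now let z in component c be the content of an addable node and z' in c'
    that of a removable node, with z = z' + k e.  If k > 0, or if k = 0 and
    c <= c', pushing the bead z - 1 down by k e from c to c' fills the gap
    z' - 1.  Otherwise pushing the bead z' down by - k e from c' to c fills the
    gap z.  Either way there is a contradiction. *)

Import Order.TTheory GRing.Theory Num.Theory.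
Local Open Scope classical_set_scope.
Local Open Scope ring_scope.

Lemma part_antitone (la : intpart) (i j : nat) :
  (i <= j)%N -> (part la j <= part la i)%N.
Proof.
move=> le_ij; rewrite /part; have /andP[srt _] := partsP la.
have [lt_j|ge_j] := ltnP j.-1 (size (parts la)); last by rewrite nth_default.
apply: (@sorted_leq_nth _ geq _ _ 0%N _ srt); rewrite ?inE.
- by move=> y x z /= le_yx le_zy; apply: leq_trans le_zy le_yx.
- by move=> x /=.
- by apply: leq_ltn_trans lt_j; lia.
- by [].
- by lia.
Qed.

(** The enlarged diagram is closed under moving left and up, and its points
    other than the new node lie in the old one: this gives the node to the left
    of (a, b) and those above it. *)
Lemma addable_node_part e l (la : multipartition l) s i a b c :
    addable_node e la s i (a, b, c) ->
  [/\ (1 <= a)%N, b = (part (la c) a).+1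
    & forall j, (1 <= j < a)%N -> (b <= part (la c) j)%N].
Proof.
case=> notin [/= a_gt0 b_gt0] _ [mu mu_def].
have in_mu g : (young_diagram la `|` [set (a, b, c)]) g = young_diagram mu g.
  by rewrite mu_def.
have [_ /andP[_ le_b]] : young_diagram mu (a, b, c) by rewrite -in_mu; right.
split=> // [|j /andP[j_gt0 lt_ja]].
- apply/eqP; rewrite eqn_leq; apply/andP; split; last first.
    by rewrite ltnNge; apply/negP=> le_b'; apply: notin; rewrite /= a_gt0 b_gt0.
  have [-> //|b_neq1] := eqVneq b 1%N.
  have : young_diagram mu (a, b.-1, c) by rewrite /=; lia.
  by rewrite -in_mu => -[/= [_]|[]]; lia.
- have : young_diagram mu (j, b, c).
    by have := part_antitone (mu c) _ _ (ltnW lt_ja); rewrite /=; lia.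
  by rewrite -in_mu => -[/= [_]|[]]; lia.
Qed.

(** A node of the old diagram to the right of (a, b) or below it would survive
    in the smaller diagram, and closure under moving left and up would put
    (a, b) back there. *)
Lemma removable_node_part e l (la : multipartition l) s i a b c :
    removable_node e la s i (a, b, c) ->
  [/\ (1 <= a)%N, b = part (la c) a
    & forall j, (a < j)%N -> (part (la c) j < b)%N].
Proof.
case=> -[/= a_gt0 /andP[b_gt0 le_b]] _ [mu mu_def].
have in_mu g : (young_diagram la `\` [set (a, b, c)]) g = young_diagram mu g.
  by rewrite mu_def.
have notin_mu : ~ young_diagram mu (a, b, c) by rewrite -in_mu => -[_]; apply.
split=> // [|j lt_aj].
- apply/eqP; rewrite eqn_leq le_b leqNgt /=; apply/negP=> lt_b.
  have : young_diagram mu (a, b.+1, c).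
    by rewrite -in_mu; split=> /=; [lia | case; lia].
  by move=> /= mu_ab; apply: notin_mu => /=; lia.
- rewrite ltnNge; apply/negP=> le_bj.
  have : young_diagram mu (j, b, c).
    by rewrite -in_mu; split=> /=; [lia | case; lia].
  have := part_antitone (mu c) _ _ (ltnW lt_aj).
  by move=> le_mu /= mu_jb; apply: notin_mu => /=; lia.
Qed.

Lemma addable_node_gap e l (la : multipartition l) s i a b c :
    addable_node e la s i (a, b, c) ->
  symbol la s c (b%:Z - a%:Z + s c - 1) /\
  ~ symbol la s c (b%:Z - a%:Z + s c).
Proof.
move=> /addable_node_part[a_gt0 b_def above]; split.
  by exists a => //; rewrite b_def; lia.
(* A row j < a has its bead above b - a, a row j >= a has it below. *)
case=> j /= j_gt0; have [lt_ja|le_aj] := ltnP j a.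
  by have := above j; rewrite j_gt0 lt_ja => /(_ isT); lia.
by have := part_antitone (la c) _ _ le_aj; lia.
Qed.

Lemma removable_node_gap e l (la : multipartition l) s i a b c :
    removable_node e la s i (a, b, c) ->
  symbol la s c (b%:Z - a%:Z + s c) /\
  ~ symbol la s c (b%:Z - a%:Z + s c - 1).
Proof.
move=> /removable_node_part[a_gt0 b_def below]; split.
  by exists a => //; rewrite b_def.
(* Row j <= a has its bead at b - a or above; the rows j > a lose at least one
   unit of length and one of index, so their beads jump over b - a - 1. *)
case=> j /= j_gt0; have [lt_aj|le_ja] := ltnP a j.
  by have := below j lt_aj; lia.
by have := part_antitone (la c) _ _ le_ja; lia.
Qed.

Lemma core_symbol_subset e l (la : multipartition l) s (c d : 'I_l) :
  is_core e la s -> (c <= d)%N -> symbol la s c `<=` symbol la s d.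
Proof.
case=> step _; case: d => d lt_dl /=.
elim: d lt_dl => [|d IHd] lt_dl le_cd.
  by have -> : c = Ordinal lt_dl by apply: val_inj => /=; lia.
have [c_eq|c_neq] := eqVneq (c : nat) d.+1.
  by have -> : c = Ordinal lt_dl by apply: val_inj.
have lt_dl' : (d < l)%N by lia.
apply: (@subset_trans _ (symbol la s (Ordinal lt_dl'))).
  by apply: IHd; lia.
exact: step.
Qed.

(** Going up from [c] to the last component, then to the first with a drop
    of [e], then up to [d]. *)
Lemma core_bead_sub_e e l (la : multipartition l) s (c d : 'I_l) (x : int) :
  is_core e la s -> symbol la s c x -> symbol la s d (x - e%:Z).
Proof.
move=> core bead.
have l_gt0 : (0 < l)%N by have := ltn_ord c; lia.
have lt_last : (l.-1 < l)%N by lia.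
have le_last : (c <= Ordinal lt_last)%N by have := ltn_ord c; rewrite /=; lia.
have [y bead_y <-] : shift_set e (symbol la s (Ordinal l_gt0)) x.
  apply: (core.2 (Ordinal l_gt0) (Ordinal lt_last) erefl erefl).
  exact: core_symbol_subset core le_last _ bead.
by rewrite addrK; apply: core_symbol_subset core _ _ bead_y.
Qed.

Lemma core_bead_below e l (la : multipartition l) s (c d : 'I_l)
    (x : int) (k : nat) :
    is_core e la s -> (0 < k)%N || (c <= d)%N ->
  symbol la s c x -> symbol la s d (x - k%:Z * e%:Z).
Proof.
move=> core; case: k => [|k] /= le_cd bead.
  by rewrite mul0r subr0; apply: core_symbol_subset core le_cd _ bead.
elim: k {le_cd} => [|k IHk]; first by rewrite mul1r; apply: core_bead_sub_e bead.
have -> : x - k.+2%:Z * e%:Z = x - k.+1%:Z * e%:Z - e%:Z by lia.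
exact: core_bead_sub_e IHk.
Qed.

Theorem proposition3p7 (e l : nat) (he : (2 <= e)%N) (hl : (1 <= l)%N)
    (s : multicharge l) (hs : in_Ae e s)
    (la : multipartition l) (hcore : is_core e la s) (i : 'I_e) :
  (~ exists g : node l, addable_node e la s i g) \/
  (~ exists g : node l, removable_node e la s i g).
Proof.
rewrite -not_andE => -[[[[a b] c] add] [[[a' b'] c'] rem]].
have [_ _ res_add _] := add; have [_ res_rem _] := rem.
have [bead gap] := addable_node_gap _ _ _ _ _ _ _ _ add.
have [bead' gap'] := removable_node_gap _ _ _ _ _ _ _ _ rem.
move: res_add res_rem bead gap bead' gap'; rewrite /has_residue.
set z := _ + s c; set z' := _ + s c' => res_add res_rem bead gap bead' gap'.
have /dvdzP[k z_eq] : (e%:Z %| z - z')%Z.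
  by rewrite -eqz_mod_dvd res_add res_rem.
have [down|up] := boolP ((0 < k) || (k == 0) && (c <= c')%N).
- apply: gap'; have -> : z' - 1 = z - 1 - `|k|%N%:Z * e%:Z.
    have -> : `|k|%N%:Z = k by lia.
    by rewrite -z_eq; lia.
  by apply: core_bead_below bead => //; lia.
- apply: gap; have -> : z = z' - `|k|%N%:Z * e%:Z.
    have -> : `|k|%N%:Z = - k by lia.
    by rewrite mulNr -z_eq; lia.
  by apply: core_bead_below bead' => //; lia.
Qed.
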